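(* Every tree $T$ of radius $h$ satisfies $\phi(T) \leq h+1$. Moreover, for every integer $h \geq 0$ there is a tree $T$ of radius $h$ such that $\phi(T) \geq h$.
   Context: Graphs are finite, simple and undirected. The radius of a tree $T$ is the minimum, over all vertices $v$ of $T$, of the maximum distance of a vertex of $T$ from $v$. An anagram is a word of the form $W_1W_2$ where $W_1$ is a non-empty word and $W_2$ is a permutation of $W_1$ (i.e. each symbol occurs equally often in $W_1$ and $W_2$). A vertex colouring of a graph $G$ is a function $f:V(G)\to C$ where $C$ is a set of colours (no properness is assumed). A vertex colouring of $G$ is anagram-free if for every path $v_1,\dots,v_n$ that is a subgraph of $G$, the sequence of colours $f(v_1)\cdots f(v_n)$ is not an anagram. The anagram-free chromatic number $\phi(G)$ is the minimum number of colours in an anagram-free vertex colouring of $G$. *)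

(* Defs.v *)
From mathcomp Require Import all_boot.
Set Implicit Arguments.
Unset Strict Implicit.
Unset Printing Implicit Defensive.

Record sgraph := SGraph {
  vertex :> finType;
  edge : rel vertex;
  edge_sym : symmetric edge;
  edge_irrefl : irreflexive edge
}.

(* A cycle is a closed walk through at least three pairwise distinct vertices:
   [ucycle] alone also accepts the empty sequence and a single edge traversed
   back and forth. *)
Definition acyclic (G : sgraph) : Prop :=
  forall c : seq G, ucycle (@edge G) c -> size c <= 2.

Definition is_tree (G : sgraph) : Prop :=
  [/\ 0 < #|G|, forall x y : G, connect (@edge G) x y & acyclic G].

Definition has_walk (G : sgraph) (x y : G) (n : nat) : bool :=
  [exists p : n.-tuple G, path (@edge G) x p && (last x p == y)].

(* Least n < #|G| such that a walk of length n joins x to y; the value is #|G|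
   exactly when x and y are not connected. *)
Definition dist (G : sgraph) (x y : G) : nat :=
  find (has_walk x y) (iota 0 #|G|).

Definition eccentricity (G : sgraph) (x : G) : nat := \max_(y : G) dist x y.

(* All eccentricities are at most #|G|, so for a non-empty graph the default
   value does not affect the minimum. *)
Definition radius (G : sgraph) : nat :=
  \big[minn/#|G|]_(x : G) eccentricity x.

(* The word splits after its first i.+1 symbols. *)
Definition anagram (C : eqType) (w : seq C) : bool :=
  [exists i : 'I_(size w), perm_eq (take i.+1 w) (drop i.+1 w)].

Lemma anagramP (C : eqType) (w : seq C) :
  reflect (exists W1 W2, [/\ W1 <> [::], perm_eq W1 W2 & w = W1 ++ W2])
          (anagram w).
Proof.
apply: (iffP existsP) => [[i Hi]|[W1 [W2 [W1n0 W12 ->]]]].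
  exists (take i.+1 w), (drop i.+1 w); split=> //; last by rewrite cat_take_drop.
  by case: w i Hi => [[]|].
have W1gt0 : 0 < size W1 by case: W1 W1n0 {W12}.
have Hi : (size W1).-1 < size (W1 ++ W2).
  by rewrite size_cat prednK // leq_addr.
by exists (Ordinal Hi); rewrite /= prednK // take_size_cat // drop_size_cat.
Qed.

Definition is_path (G : sgraph) (p : seq G) : bool :=
  uniq p && sorted (@edge G) p.

(* Quantifying over lengths at most #|G| is enough, as a path has no repeated
   vertex; see [anagram_freeP]. *)
Definition anagram_free (G : sgraph) (C : eqType) (f : G -> C) : bool :=
  [forall n : 'I_(#|G|).+1, forall p : n.-tuple G,
     is_path p ==> ~~ anagram (map f p)].

Lemma anagram_freeP (G : sgraph) (C : eqType) (f : G -> C) :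
  reflect (forall p : seq G, is_path p -> ~ anagram (map f p))
          (anagram_free f).
Proof.
apply: (iffP forallP) => [af p pP|af n].
  have Hp : size p < (#|G|).+1.
    by case/andP: pP => /card_uniqP <- _; rewrite ltnS max_card.
  have /forallP/(_ (in_tuple p))/implyP/(_ pP)/negP := af (Ordinal Hp).
  exact.
by apply/forallP=> p; apply/implyP=> /af /negP.
Qed.

Definition anagram_free_colourable (G : sgraph) (k : nat) : bool :=
  [exists f : {ffun G -> 'I_k}, anagram_free f].

Lemma anagram_free_colourableP (G : sgraph) (k : nat) :
  reflect (exists f : G -> 'I_k, anagram_free f) (anagram_free_colourable G k).
Proof.
apply: (iffP existsP) => [[f af]|[f /anagram_freeP af]]; first by exists f.
exists (finfun f); apply/anagram_freeP => p /af.
by rewrite (eq_map (ffunE f)).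
Qed.

Lemma anagram_free_colourable_ex (G : sgraph) :
  exists k, anagram_free_colourable G k.
Proof.
exists #|G|; apply/anagram_free_colourableP; exists enum_rank.
apply/anagram_freeP=> p /andP[Up _] /anagramP[W1 [W2 [W1n0 W12 Ep]]].
have: uniq (W1 ++ W2) by rewrite -Ep map_inj_uniq //; apply: enum_rank_inj.
case: W1 W1n0 W12 {Ep} => // c W1 _ /perm_mem W12.
by rewrite cat_uniq => /and3P[_ /hasPn/(_ c)]; rewrite -W12 mem_head => /(_ isT).
Qed.

Definition phi (G : sgraph) : nat := ex_minn (anagram_free_colourable_ex G).

(* Main.v *)
Require Import Defs.
From mathcomp Require Import all_boot.
From mathcomp Require Import zify.

Set Implicit Arguments.
Unset Strict Implicit.
Unset Printing Implicit Defensive.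

(** Upper bound.  Take a vertex of eccentricity at most [h] as root and colour
    each vertex by its distance to the root, which uses [h + 1] colours.  Along
    a path the least distance is attained only once: between two vertices
    attaining it, a path staying at that level or below could be prolonged
    through parents at both ends until the two ends meet, which would close a
    cycle ([level_path_nil]).  So some colour occurs exactly once along every
    non-empty path, whereas in an anagram every colour occurs an even number of
    times ([anagram_even]).

    Lower bound.  Take the complete [d]-ary tree of height [h], whose vertices
    are the words of length at most [h] over [d] letters, with [d] huge.  Given
    a colouring by at most [h] colours, the pigeonhole principle applied from
    the leaves upwards gives a complete binary subtree of the same height in
    which the colour depends on the level only ([homogeneous_exists]).  It has
    [h + 1] levels, so two of them, [i < j], have the same colour [c].  From a
    vertex [v] of level [i] go down one branch to level [j] and down another
    branch to level [j - 1].  The path joining both ends through [v] reads the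
    colours of levels [j], ..., [i + 1] and then those of levels [i], ...,
    [j - 1]: an anagram, as the levels [i] and [j] have the same colour
    ([homogeneous_anagram]). *)

(** * Distances *)

Section Distance.
Variable G : sgraph.
Implicit Types x y z : G.

Lemma has_walkP x y n :
  reflect (exists p, [/\ size p = n, path (@edge G) x p & last x p = y])
          (has_walk x y n).
Proof.
apply: (iffP existsP) => [[p /andP[pP /eqP pl]]|[p [sp pP pl]]].
  by exists p; rewrite size_tuple.
by have /eqP sp' := sp; exists (Tuple sp'); rewrite pP; apply/eqP.
Qed.

Lemma dist_le_card x y : dist x y <= #|G|.
Proof. by have := find_size (has_walk x y) (iota 0 #|G|); rewrite size_iota. Qed.

Lemma dist_le_walk x y n : has_walk x y n -> dist x y <= n.
Proof.
move=> w; have [ltn|] := ltnP n #|G|; last exact: leq_trans (dist_le_card _ _).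
rewrite leqNgt; apply/negP => /(before_find 0).
by rewrite nth_iota // add0n w.
Qed.

Lemma walk_dist x y : connect (@edge G) x y -> has_walk x y (dist x y).
Proof.
case/connectP=> p0 p0P ->; case/shortenP: p0P => p pP Up _.
have w : has_walk x (last x p) (size p) by apply/has_walkP; exists p.
have lt_p : size p < #|G|.
  by have := max_card (mem (x :: p)); rewrite (card_uniqP Up).
have hasw : has (has_walk x (last x p)) (iota 0 #|G|).
  by apply/hasP; exists (size p); rewrite // mem_iota.
have := nth_find 0 hasw; rewrite -/(dist _ _) nth_iota //.
by rewrite -[X in _ < X](size_iota 0) -has_find.
Qed.

Lemma dist_le_ecc x y : dist x y <= eccentricity x.
Proof. exact: (leq_bigmax y). Qed.

Lemma ecc_le_card x : eccentricity x <= #|G|.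
Proof. by apply/bigmax_leqP => y _; apply: dist_le_card. Qed.

Lemma radius_le_ecc x : radius G <= eccentricity x.
Proof.
rewrite /radius; have := mem_index_enum x; elim: (index_enum _) => // y s IHs.
rewrite inE big_cons => /predU1P[<-|/IHs]; first exact: geq_minl.
by apply: leq_trans; apply: geq_minr.
Qed.

Lemma le_radius n x :
  (forall y, n <= eccentricity y) -> n <= radius G.
Proof.
move=> le_n; rewrite /radius; elim/big_ind: _ => // [|a b na nb].
  exact: leq_trans (le_n x) (ecc_le_card x).
by rewrite leq_min na.
Qed.

Lemma center_exists : 0 < #|G| -> exists r : G, eccentricity r <= radius G.
Proof.
case/card_gt0P=> x _; case: (@arg_minnP _ x xpredT (fun y : G => eccentricity y)) => // r _ rmin.
by exists r; apply: (le_radius r) => y; apply: rmin.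
Qed.

End Distance.

(** * Colouring a tree by the distance to a root *)

Lemma anagram_even (C : eqType) (w : seq C) c :
  anagram w -> ~~ odd (count_mem c w).
Proof.
case/anagramP=> W1 [W2 [_ /permP W12 ->]].
by rewrite count_cat W12 addnn odd_double.
Qed.

Section UpperBound.
Variables (T : sgraph) (r : T).
Hypothesis conn : forall x y : T, connect (@edge T) x y.
Hypothesis acyc : acyclic T.

Lemma dist_root0 x : dist r x = 0 -> x = r.
Proof.
move=> d0; have := walk_dist (conn r x); rewrite d0 => /has_walkP[p [/size0nil-> _]].
by [].
Qed.

Lemma dist_parent x m :
  dist r x = m.+1 -> exists2 y, edge y x & dist r y = m.
Proof.
move=> dx; have := walk_dist (conn r x); rewrite dx => /has_walkP[p [sp pP pl]].
case/lastP: p sp pP pl => // p z; rewrite size_rcons rcons_path last_rcons.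
move=> [sp] /andP[pP e_z] zx; subst z; exists (last r p) => //.
apply/eqP; rewrite eqn_leq dist_le_walk; last by apply/has_walkP; exists p.
have /has_walkP[q [sq qP ql]] := walk_dist (conn r (last r p)).
rewrite -ltnS -dx -sq dist_le_walk //; apply/has_walkP; exists (rcons q x).
by rewrite size_rcons rcons_path last_rcons qP ql.
Qed.

(** By induction on the level: the parents of both ends lie one level above, so
    either they coincide and close a cycle, or they prolong the path into one
    that contradicts the previous level. *)
Lemma level_path_nil m x p :
  path (@edge T) x p -> uniq (x :: p) ->
  (forall z, z \in x :: p -> m <= dist r z) ->
  dist r x = m -> dist r (last x p) = m -> p = [::].
Proof.
elim: m x p => [|m IHm] x p pP Up ge_m dx dl.
  case: p Up dl {pP ge_m} => //= y p /andP[xp _] /dist_root0 eq_l.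
  by rewrite (dist_root0 dx) -eq_l mem_last in xp.
have [x' ex dx'] := dist_parent dx; have [y' ey dy'] := dist_parent dl.
have above z : dist r z = m -> z \notin x :: p.
  by move=> dz; apply/negP => /ge_m; rewrite dz ltnn.
have [eq_xy|ne_xy] := eqVneq x' y'.
  subst y'; suff /acyc: ucycle (@edge T) (x' :: x :: p) by case: (p).
  by rewrite /ucycle cons_uniq above // Up /= ex rcons_path pP edge_sym ey.
suff: rcons (x :: p) y' = [::] by [].
apply: (IHm x') => //.
- by rewrite /= ex rcons_path pP edge_sym.
- by rewrite -rcons_cons rcons_uniq inE negb_or eq_sym ne_xy cons_uniq !above.
- move=> z; rewrite in_cons mem_rcons in_cons.
  by case/or3P=> [/eqP->|/eqP->|/ge_m/ltnW]; rewrite ?dx' ?dy'.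
- by rewrite last_rcons.
Qed.

Lemma min_level_unique p v w :
  is_path p -> (forall z, z \in p -> dist r v <= dist r z) ->
  v \in p -> w \in p -> dist r w = dist r v -> w = v.
Proof.
suff sub q1 a q2 b q3 : let q := q1 ++ a :: q2 ++ b :: q3 in
    is_path q -> (forall z, z \in q -> dist r v <= dist r z) ->
    dist r a = dist r v -> dist r b = dist r v -> False.
  move=> pP vmin vp; move: pP vmin; case/splitPr: vp => p1 p2 pP vmin.
  rewrite mem_cat inE => wp dw; case/or3P: wp => [w1|/eqP //|w2].
    move: pP vmin; case/splitPr: w1 => p3 p4; rewrite -catA /= => pP vmin.
    by case: (sub _ _ _ _ _ pP vmin).
  by move: pP vmin; case/splitPr: w2 => p3 p4 pP vmin; case: (sub _ _ _ _ _ pP vmin).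
move=> q /andP[Uq]; rewrite /q sorted_cat_cons => /andP[_].
rewrite cat_path /= => /and3P[P2 eb _] vmin da db.
suff: rcons q2 b = [::] by case: (q2).
apply: (@level_path_nil (dist r v) a); rewrite ?last_rcons ?rcons_path ?P2 //.
  move: Uq; rewrite /q cat_uniq -cat_cons -cat_rcons cat_uniq rcons_cons.
  by case/and4P.
move=> z zq; apply: vmin; rewrite /q mem_cat -cat_cons -cat_rcons mem_cat rcons_cons zq.
by rewrite orbT.
Qed.

Lemma dist_anagram_free p : is_path p -> ~~ anagram (map (dist r) p).
Proof.
move=> pP; have [->|pn0] := eqVneq p [::]; first by apply/existsP=> -[[]].
have [x xp] : exists x, x \in p by case: p pn0 {pP} => // x p _; exists x; apply: mem_head.
case: (@arg_minnP _ x (mem p) (fun z : T => dist r z)) => // v vp vmin.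
apply/negP => /(anagram_even (dist r v)); rewrite count_map.
have -> : count (preim (dist r) (pred1 (dist r v))) p = count_mem v p.
  apply: eq_in_count => w wp /=; apply/eqP/eqP => [|-> //].
  exact: min_level_unique pP vmin vp wp.
by case/andP: pP => Up _; rewrite count_uniq_mem // (vp : v \in p).
Qed.

End UpperBound.

Lemma anagram_map (C D : eqType) (g : C -> D) w :
  anagram w -> anagram (map g w).
Proof.
case/anagramP=> W1 [W2 [W1n0 W12 ->]]; apply/anagramP.
exists (map g W1), (map g W2); rewrite map_cat perm_map //; split=> //.
by case: (W1) W1n0.
Qed.

Lemma phi_le (G : sgraph) k : anagram_free_colourable G k -> phi G <= k.
Proof. by rewrite /phi; case: ex_minnP => n _; apply. Qed.

Lemma tree_phi_le (T : sgraph) : is_tree T -> phi T <= radius T + 1.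
Proof.
case=> T0 conn acyc; have [r ecc_r] := center_exists T0; rewrite addn1.
apply: phi_le; apply/anagram_free_colourableP.
exists (fun x => inord (dist r x)); apply/anagram_freeP => p pP.
move/(anagram_map (@nat_of_ord _)); rewrite -map_comp.
rewrite (@eq_map _ _ _ (dist r)); first exact/negP/dist_anagram_free.
by move=> x /=; rewrite inordK // ltnS (leq_trans (dist_le_ecc r x)).
Qed.

(** * Words as vertices of a regular tree *)

Section Words.
Variable L : eqType.
Implicit Types (u v w : seq L) (a b : L) (p q : seq (seq L)).

(** The letter read first is the one added last, so that the parent of a word
    is its tail. *)
Definition child v w := (w != [::]) && (behead w == v).
Definition word_edge v w := child v w || child w v.

Lemma childP v w : reflect (exists a, w = a :: v) (child v w).
Proof.
apply: (iffP andP) => [[]|[a ->]] //=.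
by case: w => // a w _ /eqP /= ->; exists a.
Qed.

Lemma size_child v w : child v w -> size w = (size v).+1.
Proof. by case/childP=> a ->. Qed.

Lemma word_edge_sym : symmetric word_edge.
Proof. by move=> v w; rewrite /word_edge orbC. Qed.

Lemma word_edge_irrefl : irreflexive word_edge.
Proof. by move=> v; apply/norP; split; apply/negP => /size_child; lia. Qed.

Lemma word_edge_longest v w : word_edge v w -> size w <= size v -> behead v = w.
Proof.
case/orP=> [/size_child ->|]; first by rewrite ltnn.
by case/andP=> _ /eqP.
Qed.

Lemma path_child_size v p :
  path child v p -> map size p = iota (size v).+1 (size p).
Proof. by elim: p v => //= w p IHp v /andP[/size_child <- /IHp ->]. Qed.

Lemma path_child_uniq v p : path child v p -> uniq (v :: p).
Proof.
move=> /path_child_size sp; apply: (@map_uniq _ _ size).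
by rewrite map_cons sp -[_ :: _]/(iota (size v) (size p).+1) iota_uniq.
Qed.

Lemma path_child_le v p w : path child v p -> w \in v :: p -> size w <= size v + size p.
Proof.
rewrite inE => /path_child_size sp /predU1P[->|/(map_f size)]; first exact: leq_addr.
by rewrite sp mem_iota => /andP[_]; rewrite addSn.
Qed.

Lemma path_child_suffix v p w : path child v p -> w \in v :: p -> suffix v w.
Proof.
elim: p v => [|u p IHp] v /=; first by rewrite inE => _ /eqP->; apply: suffix_refl.
case/andP=> /childP[a ->] /IHp{}IHp; rewrite inE => /predU1P[->|/IHp].
  exact: suffix_refl.
exact/suffix_trans/suffix_cons.
Qed.

Lemma path_child_edge v p : path child v p -> path word_edge v p.
Proof. by apply: sub_path => u w uw; rewrite /word_edge uw. Qed.

(** The branches are disjoint because every word of a descent has the first word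
    of the descent as a suffix. *)
Lemma branches_path v a b p q :
  a != b -> path child (a :: v) p -> path child (b :: v) q ->
  uniq (rev ((a :: v) :: p) ++ v :: (b :: v) :: q) &&
  sorted word_edge (rev ((a :: v) :: p) ++ v :: (b :: v) :: q).
Proof.
move=> ne_ab pP qP.
have vP c : child v (c :: v) by apply/childP; exists c.
have vpP : path child v ((a :: v) :: p) by rewrite /= vP.
have vqP : path child v ((b :: v) :: q) by rewrite /= vP.
have := path_child_uniq vpP; rewrite cons_uniq => /andP[vp Up].
apply/andP; split.
  rewrite cat_uniq rev_uniq Up (path_child_uniq vqP) andbT -all_predC.
  apply/allP => w; rewrite in_cons /= mem_rev => /predU1P[->//|/(path_child_suffix qP) sb].
  apply/negP => /(path_child_suffix pP) sa.
  move: sa sb; rewrite !suffixE /= => /eqP-> /eqP[eq_ab].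
  by rewrite eq_ab eqxx in ne_ab.
rewrite sorted_cat_cons -rev_cons rev_sorted.
rewrite (eq_sorted (e' := word_edge)) => [|x y]; last exact: word_edge_sym.
by apply/andP; split; apply: path_child_edge.
Qed.

End Words.

(** * Level-coloured subtrees *)

Lemma not_uniq_split (A : eqType) (s : seq A) :
  ~~ uniq s -> exists c s1 s2 s3, s = s1 ++ c :: s2 ++ c :: s3.
Proof.
elim: s => //= x s IHs; rewrite negb_and negbK => /orP[/splitPr[s2 s3]|/IHs].
  by exists x, [::], s2, s3.
by case=> c [s1 [s2 [s3 ->]]]; exists c, (x :: s1), s2, s3.
Qed.

Section Homogeneous.
Variables (L C : finType) (g : seq L -> C).
Implicit Types (v : seq L) (s t : seq C).

(** Below [v] lies a complete binary subtree whose levels are coloured by the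
    successive entries of [s].  Requiring two letters at the last level as well
    keeps the recursion uniform. *)
Fixpoint homogeneous v s : bool :=
  if s is c :: s' then
    (g v == c) && [exists a, exists b,
      [&& a != b, homogeneous (a :: v) s' & homogeneous (b :: v) s']]
  else true.

Lemma homogeneousP v c s :
  reflect (g v = c /\ exists a b,
             [/\ a != b, homogeneous (a :: v) s & homogeneous (b :: v) s])
          (homogeneous v (c :: s)).
Proof.
apply: (iffP andP) => [[/eqP-> /existsP[a /existsP[b /and3P ab]]]|].
  by split=> //; exists a, b.
case=> -> [a [b /and3P ab]]; split=> //.
by apply/existsP; exists a; apply/existsP; exists b.
Qed.

(** Two of the children of [v] carry subtrees with the same sequence of level
    colours, since there are more letters than such sequences. *)
Lemma homogeneous_exists n v :
  #|C| ^ n < #|L| -> exists s : n.-tuple C, homogeneous v s.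
Proof.
elim: n v => [|n IHn] v ltCL; first by exists [tuple].
have C0 : 0 < #|C| by apply/card_gt0P; exists (g v).
have ltCL' : #|C| ^ n < #|L|.
  by apply: leq_ltn_trans ltCL; rewrite leq_pexp2l.
have /fin_all_exists[t tP] : forall a, exists s : n.-tuple C, homogeneous (a :: v) s.
  by move=> a; apply: IHn.
have /injectivePn[a [b ne_ab eq_t]] : ~~ injectiveb t.
  by apply/injectiveP => /leq_card; rewrite card_tuple leqNgt ltCL'.
exists [tuple of g v :: t a]; apply/homogeneousP; split=> //.
by exists a, b; rewrite ne_ab; split; rewrite // eq_t.
Qed.

Lemma homogeneous_catl v s t : homogeneous v (s ++ t) -> homogeneous v s.
Proof.
elim: s v => // c s IHs v /homogeneousP[gv [a [b [ne_ab /IHs ha /IHs hb]]]].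
by apply/homogeneousP; split=> //; exists a, b.
Qed.

Lemma homogeneous_catr v s t :
  homogeneous v (s ++ t) ->
  exists2 w, size w = size v + size s & homogeneous w t.
Proof.
elim: s v => [|c s IHs] v; first by exists v; rewrite ?addn0.
case/homogeneousP=> _ [a [_ [_ /IHs[w sw hw] _]]].
by exists w; rewrite // sw addnS.
Qed.

Lemma homogeneous_descent v c s :
  homogeneous v (c :: s) -> exists2 p, path (@child L) v p & map g (v :: p) = c :: s.
Proof.
elim: s v c => [|c' s IHs] v c /homogeneousP[gv [a [_ [_ ha _]]]].
  by exists [::]; rewrite //= gv.
have [p pP gp] := IHs _ _ ha; exists ((a :: v) :: p); last by rewrite map_cons gp gv.
by rewrite /= pP andbT; apply/childP; exists a.
Qed.

(** If levels [i < j] share a colour, then levels [i], ..., [j - 1] and levels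
    [i + 1], ..., [j] carry the same multiset of colours, and the two branches
    below a vertex of level [i] provide disjoint copies of them. *)
Lemma homogeneous_anagram s :
  homogeneous [::] s -> ~~ uniq s ->
  exists p : seq (seq L),
    [/\ uniq p && sorted (@word_edge L) p,
        forall w, w \in p -> size w < size s & anagram (map g p)].
Proof.
move=> + /not_uniq_split[c [s1 [s2 [s3 def_s]]]]; rewrite def_s.
case/homogeneous_catr=> v; rewrite add0n => sv; rewrite -cat_rcons.
case/homogeneousP=> gv [a [b [ne_ab /homogeneous_catl ha /homogeneous_catl hb]]].
have below e : homogeneous (e :: v) (rcons s2 c) ->
    exists2 p, path (@child L) (e :: v) p & map g ((e :: v) :: p) = rcons s2 c.
  by case def_r: (rcons s2 c) => [|c' r]; [case: (s2) def_r | apply: homogeneous_descent].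
have [p pP gp] := below _ ha; have [q qP gq] := below _ hb.
have := branches_path ne_ab pP qP.
have := path_child_le pP; have := path_child_le qP.
have size_below e r : map g ((e :: v) :: r) = rcons s2 c -> size r = size s2.
  by move/(congr1 size); rewrite /= size_map size_rcons => -[].
rewrite (size_below _ _ gp) (size_below _ _ gq) => q_le p_le.
have : map g (rev ((a :: v) :: p) ++ v :: (b :: v) :: q)
       = rcons (rev (rcons s2 c) ++ c :: s2) c.
  by rewrite map_cat map_rev gp map_cons gv gq rcons_cat.
have r_le w : w \in rev ((a :: v) :: p) ++ v :: (b :: v) :: q ->
    size w < size (s1 ++ c :: rcons s2 c ++ s3).
  rewrite mem_cat mem_rev in_cons size_cat /= size_cat size_rcons -sv.
  by case/or3P=> [/p_le|/eqP->|/q_le] /=; lia.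
(* The second branch is followed one level too far, and the last vertex is
   dropped; this avoids a case distinction on an empty branch. *)
move: r_le; case/lastP: (_ ++ _) => [_|r z r_le]; first by move/(congr1 size); rewrite size_rcons.
rewrite map_rcons => /rcons_inj[gr _]; rewrite rcons_uniq -cats1.
case/andP=> /andP[_ Ur] /cat_sorted2[Sr _].
exists r; rewrite Ur Sr; split=> // [w wr|].
  by apply: r_le; rewrite mem_rcons inE wr orbT.
rewrite gr; apply/anagramP; exists (rev (rcons s2 c)), (c :: s2); split=> //.
  by rewrite rev_rcons.
by rewrite rev_rcons perm_cons perm_rev.
Qed.

End Homogeneous.

(** * The complete regular tree *)

Section RegularTree.
Variables (L : finType) (h : nat).

Definition vertex_edge : rel (h.-bseq L) := fun v w => word_edge v w.

Lemma vertex_edge_sym : symmetric vertex_edge.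
Proof. by move=> v w; apply: word_edge_sym. Qed.

Lemma vertex_edge_irrefl : irreflexive vertex_edge.
Proof. by move=> v; apply: word_edge_irrefl. Qed.

Definition regular_tree := SGraph vertex_edge_sym vertex_edge_irrefl.

Definition root : regular_tree := [bseq].

(** A longest word of a cycle has only one neighbour on it, its parent. *)
Lemma regular_tree_acyclic : acyclic regular_tree.
Proof.
move=> c /andP[cc Uc]; rewrite leqNgt; apply/negP => sc.
have [x xc] : exists x, x \in c by case: c sc {cc Uc} => // x c _; exists x; apply: mem_head.
case: (@arg_maxnP _ x (mem c) (fun v : h.-bseq L => size v)) => // v vc vmax.
have [i q def_c] := rot_to vc.
have qmax w : w \in q -> size (w : h.-bseq L) <= size (v : h.-bseq L).
  by move=> wq; apply: vmax; rewrite inE -(mem_rot i) def_c inE wq orbT.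
move: sc cc Uc; rewrite -(size_rot i) -(rot_cycle i) -(rot_uniq i) def_c.
case: q qmax {def_c} => // y q; case/lastP: q => // q z qmax _.
rewrite /= rcons_path last_rcons => /and3P[vy _ zv] /and3P[_ + _].
rewrite mem_rcons inE negb_or => /andP[/eqP ne_yz _]; apply: ne_yz; apply: val_inj.
have le_y := qmax y (mem_head _ _).
have le_z : size (z : h.-bseq L) <= size (v : h.-bseq L).
  by apply: qmax; rewrite inE mem_rcons mem_head orbT.
have vz : vertex_edge v z by rewrite vertex_edge_sym.
exact: etrans (esym (word_edge_longest vy le_y)) (word_edge_longest vz le_z).
Qed.

Lemma walk_root (v : regular_tree) : has_walk root v (size (v : h.-bseq L)).
Proof.
case: v => s; elim: s => [|a s IHs] sh.
  by apply/has_walkP; exists [::]; split=> //; apply: val_inj.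
have /has_walkP[p [sp pP pl]] := IHs (ltnW sh).
apply/has_walkP; exists (rcons p (Bseq sh : regular_tree)).
rewrite size_rcons sp rcons_path pP pl last_rcons; split=> //=.
by rewrite /vertex_edge /word_edge; apply/orP; left; apply/childP; exists a.
Qed.

Lemma regular_tree_is_tree : is_tree regular_tree.
Proof.
split; [by apply/card_gt0P; exists root | | exact: regular_tree_acyclic].
have conn0 v : connect (@edge regular_tree) root v.
  by have /has_walkP[p [_ pP <-]] := walk_root v; apply/connectP; exists p.
move=> x y; apply: connect_trans (conn0 y).
by rewrite (sym_connect_sym (@edge_sym regular_tree)).
Qed.

(** The last letter of a word names the branch below the root that contains it.
    This function changes by at most one along an edge, hence its variation
    bounds distances from below. *)
Definition branch_depth b (v : seq L) :=
  if last b v == b then size v else 0.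

Lemma branch_depth_edge b v w :
  word_edge v w -> branch_depth b w <= (branch_depth b v).+1.
Proof.
rewrite /branch_depth; case/orP=> /childP[a ->].
  by case: v => [|c v] /=; case: ifP.
by case: w => [|c w] /=; case: ifP => // _; apply/ltnW/ltnW.
Qed.

Lemma branch_depth_walk b (x y : regular_tree) n :
  has_walk x y n -> branch_depth b (y : h.-bseq L) <= branch_depth b (x : h.-bseq L) + n.
Proof.
case/has_walkP=> p [<- + <-]; elim: p x => [|z p IHp] x /=; first by rewrite addn0.
case/andP=> /(branch_depth_edge b) xz /IHp/leq_trans; apply.
by rewrite addnS -addSn leq_add2r.
Qed.

(** Away from the branch of [x] there is a leaf, at distance at least [h]. *)
Lemma regular_tree_radius : 1 < #|L| -> radius regular_tree = h.
Proof.
move=> /card_gt1P[a [b [_ _ ne_ab]]].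
have [_ conn _] := regular_tree_is_tree.
apply/eqP; rewrite eqn_leq; apply/andP; split.
  apply: leq_trans (radius_le_ecc root) _; apply/bigmax_leqP => v _.
  exact: leq_trans (dist_le_walk (walk_root v)) (size_bseq _).
apply: (le_radius root) => x.
have [b' xb'] : exists b', branch_depth b' (x : h.-bseq L) = 0.
  rewrite /branch_depth; case: {x}(x : h.-bseq L) => -[|c s] _ /=.
    by exists a; rewrite eqxx.
  have [eq_a|ne] := eqVneq (last c s) a; last by exists a; rewrite (negbTE ne).
  by exists b; rewrite eq_a (negbTE ne_ab).
have sh : size (nseq h b') <= h by rewrite size_nseq.
apply: leq_trans (dist_le_ecc x (Bseq sh : regular_tree)).
have := branch_depth_walk b' (walk_dist (conn x (Bseq sh : regular_tree))).
rewrite xb' add0n; apply: leq_trans.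
have -> : branch_depth b' (nseq h b') = h; last by [].
rewrite /branch_depth size_nseq (_ : last _ _ = b') ?eqxx //.
by elim: h.
Qed.

(** A level-coloured binary subtree of height [h] has [h.+1] levels, so with
    at most [h] colours two levels share one. *)
Lemma regular_tree_not_colourable k :
  k <= h -> k ^ h.+1 < #|L| -> ~~ anagram_free_colourable regular_tree k.
Proof.
move=> le_kh ltkL; apply/anagram_free_colourableP => -[f /anagram_freeP af].
pose g (w : seq L) := f (insub_bseq h w).
have [|s hs] := @homogeneous_exists _ _ g h.+1 [::]; first by rewrite card_ord.
have nUs : ~~ uniq s.
  apply/negP => /card_uniqP eq_s; have := max_card (mem s).
  by rewrite eq_s size_tuple card_ord; lia.
have [p [/andP[Up Sp] ple gp]] := homogeneous_anagram hs nUs.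
pose q : seq regular_tree := map (@insub_bseq h L) p.
have valK : map (@bseqval h L) q = p.
  rewrite -map_comp -[RHS]map_id; apply/eq_in_map => w /ple; rewrite size_tuple => wh.
  by rewrite /= /insub_bseq -[bseqval _]/(val _) insubdK.
apply: (af q); last by rewrite -map_comp.
apply/andP; split; first by apply: (@map_uniq _ _ (@bseqval h L)); rewrite valK.
by move: Sp; rewrite -valK sorted_map.
Qed.

End RegularTree.

Theorem theorem4 :
  (forall (h : nat) (T : sgraph), is_tree T -> radius T = h -> phi T <= h + 1)
  /\
  (forall h : nat, exists T : sgraph, [/\ is_tree T, radius T = h & h <= phi T]).
Proof.
split=> [h T treeT <-|h]; first exact: tree_phi_le.
pose L : finType := 'I_(h ^ h.+1).+2.
have L2 : 1 < #|L| by rewrite card_ord.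
exists (regular_tree L h); split.
- exact: regular_tree_is_tree.
- exact: regular_tree_radius.
rewrite /phi; case: ex_minnP => k colk _; rewrite leqNgt; apply: contraL colk => lt_kh.
apply: regular_tree_not_colourable => //; first exact: ltnW.
by rewrite card_ord ltnS ltnW // ltnS leq_exp2r // ltnW.
Qed.
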